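(* For integers $n\ge2$ and $1-n\le m\le n$, define the sequence $(d_{m,n,k})_{k\ge1}$ by $d_{m,n,1}=n$, $d_{m,n,2}=n^2+2m$, and $d_{m,n,k}=n\,d_{m,n,k-1}+m\,d_{m,n,k-2}$ for $k\ge3$. For all integers $n\ge2$ and $1-n\le m\le n$, setting $\phi_{d_{m,n}}(k)=d_{m,n,k}$, we have $\Phi_1(k,\phi_{d_{m,n}})\equiv0\pmod k$ for all integers $k\ge1$. Moreover, the generating function $G_{d_{m,n}}(z)=\sum_{k\ge1}d_{m,n,k}z^k$ equals $$G_{d_{m,n}}(z)=\frac{nz+2mz^2}{1-nz-mz^2}.$$
   Context: For an integer-valued function $\phi$ on the positive integers: $\Phi_1(1,\phi)=\phi(1)$, and if $N=p_1^{k_1}\cdots p_r^{k_r}$ with $p_1,\dots,p_r$ distinct primes and $r,k_i\ge1$, then $\Phi_1(N,\phi)=\sum_{T\subseteq\{1,\dots,r\}}(-1)^{|T|}\phi\big(N/\prod_{i\in T}p_i\big)$ (empty product $=1$). *)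

(* Defs.v *)
From HB Require Import structures.
From mathcomp Require Import all_boot all_order all_algebra.
Set Implicit Arguments.
Unset Strict Implicit.
Unset Printing Implicit Defensive.

Import Order.TTheory GRing.Theory Num.Theory.
Local Open Scope ring_scope.

(* T ranges over sets of indices into the list [primes N] of distinct prime
   divisors of N.  For N = 1 this list is empty, only T = set0 occurs and the
   sum is phi 1 (lemma Phi1_1).  For N > 0 the function phi is only evaluated
   at positive integers. *)
Definition Phi1 (N : nat) (phi : nat -> int) : int :=
  \sum_(T : {set 'I_(size (primes N))})
     (-1) ^+ #|T| * phi (N %/ \prod_(i in T) nth 0%N (primes N) i)%N.

Lemma Phi1_1 (phi : nat -> int) : Phi1 1 phi = phi 1%N.
Proof.
rewrite /Phi1 (big_pred1 set0) => [|T].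
  by rewrite cards0 expr0 mul1r big_set0.
by apply/esym/eqP/setP => -[].
Qed.

(* The sequence is indexed from 1; its value at 0 is a placeholder. *)
Fixpoint d (m n : int) (k : nat) {struct k} : int :=
  match k with
  | 0%N => 0
  | 1%N => n
  | 2%N => n ^+ 2 + 2 * m
  | ((_.+1 as k2).+1 as k1).+1 => n * d m n k1 + m * d m n k2
  end.

(* A formal power series is its sequence of coefficients. *)
Definition fps (R : comUnitRingType) := nat -> R.

Definition fps_of_poly (R : comUnitRingType) (p : {poly R}) : fps R := fun k => p`_k.

Definition fps_mul (R : comUnitRingType) (f g : fps R) : fps R :=
  fun k => \sum_(i < k.+1) f i * g (k - i)%N.

(* First k coefficients of 1 / f, by solving f * g = 1 degree by degree;
   meaningful when f 0 is a unit (lemma fps_mulV). *)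
Fixpoint fps_inv_seq (R : comUnitRingType) (f : fps R) (k : nat) : seq R :=
  if k is j.+1 then
    let s := fps_inv_seq f j in
    rcons s (((j == 0%N)%:R - \sum_(i < j) f (j - i)%N * s`_i) / f 0%N)
  else [::].

Definition fps_inv (R : comUnitRingType) (f : fps R) : fps R := fun k => (fps_inv_seq f k.+1)`_k.

Definition fps_div (R : comUnitRingType) (f g : fps R) : fps R := fps_mul f (fps_inv g).

Lemma size_fps_inv_seq (R : comUnitRingType) (f : fps R) k : size (fps_inv_seq f k) = k.
Proof. by elim: k => //= k IHk; rewrite size_rcons IHk. Qed.

Lemma nth_fps_inv_seq (R : comUnitRingType) (f : fps R) k i :
  (i < k)%N -> (fps_inv_seq f k)`_i = fps_inv f i.
Proof.
elim: k => // k IHk; rewrite ltnS leq_eqVlt => /orP[/eqP-> //|lt_ik].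
by rewrite /= nth_rcons size_fps_inv_seq lt_ik IHk.
Qed.

Lemma fps_mulV (R : comUnitRingType) (f : fps R) :
  f 0%N \is a GRing.unit -> fps_mul f (fps_inv f) =1 fps_of_poly 1.
Proof.
move=> f0 k; rewrite /fps_mul /fps_of_poly coef1 big_ord_recl /= subn0.
rewrite {1}/fps_inv /= nth_rcons size_fps_inv_seq ltnn eqxx mulrC divrK //.
rewrite [X in _ + X](reindex_inj rev_ord_inj) /= 
  -[RHS](subrK (\sum_(i < k) f (k - i)%N * (fps_inv_seq f k)`_i)).
congr (_ + _); apply: eq_bigr => i _; rewrite nth_fps_inv_seq //.
have -> : bump 0 (k - i.+1) = (k - i)%N by rewrite /bump /= add1n subnSK.
by rewrite subKn // ltnW.
Qed.

(* The formal power series \sum_(k >= 1) a_k z^k. *)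
Definition genfun (a : nat -> int) : fps int :=
  fun k => if k is 0%N then 0 else a k.

(* Main.v *)
Require Import Defs.
From HB Require Import structures.
From mathcomp Require Import all_boot all_order all_algebra.
From mathcomp Require Import algC ring.
Import Order.TTheory GRing.Theory Num.Theory.
Local Open Scope ring_scope.

(** With [t = n] and [e = - m], the sequence is the power sum
    [L_k(t, e) = x^k + y^k] of the roots of [X^2 - t X + e], so that
    [L_(ab)(t, e) = L_a(L_b(t, e), e^b)].  For a prime [p] one has
    [L_p(t, e) = t^p + p Q(t, e)] with [Q] an integral polynomial.  Hence the map
    [Psi(t, e) = (L_p(t, e), e^p)] is the identity modulo [p], and it turns
    congruences modulo [p^j] ([j > 0]) into congruences modulo [p^(j+1)].
    Iterating gives [Psi^(a+1) = Psi^a] modulo [p^(a+1)], that is,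
    [L_(s p^(a+1)) = L_(s p^a)] modulo [p^(a+1)].  Grouping the terms of [Phi1 k]
    in pairs that differ by one prime [p] then shows that the [p]-part of [k]
    divides it, for every [p]. *)

(** * Lucas sequences *)

Fixpoint lucas (t e : int) (k : nat) : int :=
  match k with
  | 0%N => 2
  | 1%N => t
  | (k1.+1 as k2).+1 => t * lucas t e k2 - e * lucas t e k1
  end.

Lemma lucasSS t e k : lucas t e k.+2 = t * lucas t e k.+1 - e * lucas t e k.
Proof. by []. Qed.

Lemma d_lucas m n k : (0 < k)%N -> d m n k = lucas n (- m) k.
Proof.
(* Index 0 is excluded because [d] has the placeholder 0 there while [lucas] has 2. Hence [k = 2] is
   a base case. *)
elim/ltn_ind: k => -[|[|[|k]]] // IHk _; first by rewrite /=; ring.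
rewrite lucasSS -!IHk //=; ring.
Qed.

Lemma quadratic_roots (t e : int) :
  exists x y : algC, x + y = t%:~R /\ x * y = e%:~R.
Proof.
pose s : algC := sqrtC (t%:~R ^+ 2 - 4 * e%:~R).
have sE : s ^+ 2 = t%:~R ^+ 2 - 4 * e%:~R by rewrite sqrtCK.
exists ((t%:~R + s) / 2), ((t%:~R - s) / 2); split; first by field.
rewrite [LHS](_ : _ = (t%:~R ^+ 2 - s ^+ 2) / 4); last by field.
by rewrite sE; field.
Qed.

(** Binet's formula: since integers embed in [algC], integer identities between Lucas values can be
    checked on the roots. *)
Lemma lucas_roots (t e : int) (x y : algC) k :
  x + y = t%:~R -> x * y = e%:~R -> (lucas t e k)%:~R = x ^+ k + y ^+ k.
Proof.
move=> xyt xye; elim/ltn_ind: k => -[|[|k]] IHk //.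
by rewrite lucasSS intrB !intrM !IHk // -xyt -xye !exprS; ring.
Qed.

Lemma lucasM t e a b : lucas t e (a * b) = lucas (lucas t e b) (e ^+ b) a.
Proof.
have [x [y [xyt xye]]] := quadratic_roots t e.
apply: (@intr_inj algC); rewrite (lucas_roots _ _ x y) //.
rewrite (lucas_roots _ _ (x ^+ b) (y ^+ b)) ?(lucas_roots _ _ x y) //.
  by rewrite -!exprM mulnC.
by rewrite -exprMn xye rmorphXn.
Qed.

(* [x ^+ i * y ^+ j + x ^+ j * y ^+ i] in terms of [t = x + y], [e = x * y] *)
Definition lucas2 (t e : int) (i j : nat) : int :=
  e ^+ minn i j * lucas t e (maxn i j - minn i j).

Lemma lucas2_roots (t e : int) (x y : algC) i j :
  x + y = t%:~R -> x * y = e%:~R ->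
  (lucas2 t e i j)%:~R = x ^+ i * y ^+ j + x ^+ j * y ^+ i.
Proof.
move=> xyt xye; rewrite /lucas2 rmorphM rmorphXn /= -xye (lucas_roots _ _ x y) //.
wlog le_ij : i j / (i <= j)%N => [IH|].
  have /orP[/IH //|/IH] := leq_total i j.
  by rewrite minnC maxnC => ->; exact: addrC.
rewrite (minn_idPl le_ij) (maxn_idPr le_ij) -{3 4}(subnKC le_ij) !exprD exprMn.
ring.
Qed.

(** Adding the expansions of [(x + y) ^+ k] and [(y + x) ^+ k] makes every term symmetric in the
    roots, hence an integer. *)
Lemma lucas2_binomial t e k :
  2 * t ^+ k = \sum_(i < k.+1) lucas2 t e (k - i) i *+ 'C(k, i).
Proof.
have [x [y [xyt xye]]] := quadratic_roots t e.
apply: (@intr_inj algC); rewrite rmorphM rmorphXn rmorph_sum /= -xyt.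
under eq_bigr => i _ do rewrite rmorphMn /= (lucas2_roots _ _ x y) // mulrnDl.
rewrite big_split /= -exprDn mulrDl mul1r; congr (_ + _).
by rewrite addrC exprDn; apply: eq_bigr => i _; rewrite mulrC.
Qed.

(** The two extreme terms are split off; when [k.+1] is prime it divides all the remaining binomial
    coefficients. *)
Lemma lucas2_binomialS t e k :
  2 * t ^+ k.+1 = 2 * lucas t e k.+1 +
    \sum_(i < k) lucas2 t e (k - i) i.+1 *+ 'C(k.+1, i.+1).
Proof.
rewrite (lucas2_binomial t e) big_ord_recl big_ord_recr /= binn subnn.
rewrite subn0 bin0 /lucas2 minn0 maxn0 min0n max0n subn0 expr0 mul1r !mulr1n.
by rewrite addrCA addrC mulrDl mul1r.
Qed.

(** * Congruence-preserving functions *)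

(** Stands in for integral polynomials in [t] and [e]: respecting congruences is the only property
    of [Q] that the lifting uses. *)
Definition congruence_preserving (F : int -> int -> int) :=
  forall (q t t' e e' : int), (q %| t - t')%Z -> (q %| e - e')%Z ->
    (q %| F t e - F t' e')%Z.

Lemma congruence_preservingD F G :
  congruence_preserving F -> congruence_preserving G ->
  congruence_preserving (fun t e => F t e + G t e).
Proof.
by move=> cF cG q t t' e e' qt qe; rewrite opprD addrACA rpredD ?cF ?cG.
Qed.

Lemma congruence_preservingM F G :
  congruence_preserving F -> congruence_preserving G ->
  congruence_preserving (fun t e => F t e * G t e).
Proof.
move=> cF cG q t t' e e' qt qe.
rewrite [X in (_ %| X)%Z](_ : _ =
  (F t e - F t' e') * G t e + F t' e' * (G t e - G t' e')); last by ring.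
by apply: rpredD; [rewrite dvdz_mulr ?cF | rewrite dvdz_mull ?cG].
Qed.

Lemma congruence_preserving_cst c : congruence_preserving (fun _ _ => c).
Proof. by move=> q t t' e e' _ _; rewrite subrr dvdz0. Qed.

Lemma congruence_preservingN F :
  congruence_preserving F -> congruence_preserving (fun t e => - F t e).
Proof. by move=> cF q t t' e e' qt qe; rewrite -opprD rpredN cF. Qed.

Lemma congruence_preservingX F k :
  congruence_preserving F -> congruence_preserving (fun t e => F t e ^+ k).
Proof.
by move=> cF q t t' e e' qt qe; rewrite subrXX dvdz_mulr ?cF.
Qed.

Lemma congruence_preserving_sum (I : finType) (F : I -> int -> int -> int) :
  (forall i, congruence_preserving (F i)) ->
  congruence_preserving (fun t e => \sum_i F i t e).
Proof.
move=> cF q t t' e e' qt qe; rewrite -sumrB rpred_sum // => i _.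
exact: cF.
Qed.

Lemma lucas_congruence k : congruence_preserving (fun t e => lucas t e k).
Proof.
elim/ltn_ind: k => -[|[|k]] IHk; first exact: congruence_preserving_cst.
  by [].
apply: congruence_preservingD; last apply: congruence_preservingN.
  by apply: congruence_preservingM; [|apply: (IHk k.+1)].
by apply: congruence_preservingM; [|apply: (IHk k)].
Qed.

Lemma lucas2_congruence i j : congruence_preserving (fun t e => lucas2 t e i j).
Proof.
apply: congruence_preservingM; first exact: congruence_preservingX.
exact: lucas_congruence.
Qed.

(** * The Gauss congruences *)

(* For odd [p = 2 r + 1], the binomial expansion gives
   [2 (lucas t e p - t ^+ p) = - p W]; hence
   [lucas t e p - t ^+ p = p (lucas t e p - t ^+ p + r W)], which avoids
   dividing [W] by 2. *)
Lemma lucas_prime p : prime p ->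
  exists2 Q, congruence_preserving Q &
    forall t e, lucas t e p = t ^+ p + p%:Z * Q t e.
Proof.
move=> p_pr; have [->|p_odd] := even_prime p_pr.
  exists (fun _ e => - e) => [|t e]; first exact: congruence_preservingN.
  by rewrite /=; ring.
pose c i : int := ('C(p, i.+1) %/ p)%N.
pose W t e := \sum_(i < p.-1) c i * lucas2 t e (p - i.+1) i.+1.
exists (fun t e => lucas t e p + - t ^+ p + p./2%:Z * W t e) => [|t e].
  apply: congruence_preservingD.
    apply: congruence_preservingD; first exact: lucas_congruence.
    exact/congruence_preservingN/congruence_preservingX.
  apply: congruence_preservingM; first exact: congruence_preserving_cst.
  apply: congruence_preserving_sum => i.
  apply: congruence_preservingM; first exact: congruence_preserving_cst.
  exact: lucas2_congruence.
have WE : 2 * t ^+ p = 2 * lucas t e p + p%:Z * W t e.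
  have pP := prednK (prime_gt0 p_pr).
  have := lucas2_binomialS t e p.-1; rewrite pP => ->.
  congr (_ + _); rewrite mulr_sumr; apply: eq_bigr => i _.
  rewrite mulrA -PoszM mulnC divnK; last first.
    by apply: prime_dvd_bin => //=; rewrite -[X in (_ < X)%N]pP ltnS.
  by rewrite -mulr_natl natz -predn_sub -subnS.
have pE : p%:Z = 2 * p./2%:Z + 1.
  by rewrite -{1}(odd_double_half p) p_odd -mul2n PoszD PoszM addrC.
have pW : p%:Z * W t e = 2 * t ^+ p - 2 * lucas t e p by rewrite WE; ring.
rewrite mulrDr mulrCA pW pE; ring.
Qed.

Lemma dvdz_exp_prime_sub (p : nat) (x : int) :
  prime p -> (p%:Z %| x ^+ p - x)%Z.
Proof.
move=> p_pr; have p0 : p%:Z != 0 by rewrite eqz_nat -lt0n prime_gt0.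
rewrite -eqz_mod_dvd -modzXm -[X in _ == X]modz_mod.
have: 0 <= (x %% p)%Z by rewrite modz_ge0.
case: (x %% p)%Z => // r _.
by rewrite -rmorphXn /= !modz_nat eqz_nat; apply/eqP/fermat_little.
Qed.

(** The cofactor of [t - t'] in [t ^+ p - t' ^+ p] is congruent to [p * t ^+ p.-1] modulo [p],
    because [p] divides [q] and hence [t - t']. It supplies the extra factor [p]. *)
Lemma dvdz_expB (p : nat) (q t t' : int) :
  (p%:Z %| q)%Z -> (q %| t - t')%Z -> (q * p %| t ^+ p - t' ^+ p)%Z.
Proof.
move=> pq qt; rewrite subrXX dvdz_mul //.
have -> : \sum_(i < p) t ^+ (p.-1 - i) * t' ^+ i =
    \sum_(i < p) (t ^+ (p.-1 - i) * (t' ^+ i - t ^+ i)) + p%:Z * t ^+ p.-1.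
  rewrite -natz mulr_natl -[X in _ *+ X]card_ord -sumr_const -big_split /=.
  apply: eq_bigr => i _; rewrite mulrBr -exprD subnK ?subrK //.
  by rewrite -ltnS (ltn_predK (ltn_ord i)).
rewrite rpredD ?dvdz_mulr // rpred_sum // => i _.
rewrite dvdz_mull // subrXX dvdz_mulr // -opprB rpredN.
exact: dvdz_trans qt.
Qed.

Lemma lucas_prime_lift (p : nat) (q t t' e e' : int) :
  prime p -> (p%:Z %| q)%Z -> (q %| t - t')%Z -> (q %| e - e')%Z ->
  (q * p %| lucas t e p - lucas t' e' p)%Z.
Proof.
move=> p_pr pq qt qe; have [Q cQ QE] := lucas_prime p p_pr.
rewrite !QE opprD addrACA -mulrBr rpredD ?dvdz_expB //.
by rewrite mulrC dvdz_mul // cQ.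
Qed.

(** Both components of the iterate of [Psi] are carried along, since each lift of the first needs
    the congruence of the second. *)
Lemma lucas_pfactor_lift (p a : nat) (t t' e e' : int) :
  prime p -> (p%:Z %| t - t')%Z -> (p%:Z %| e - e')%Z ->
  (p%:Z ^+ a.+1 %| lucas t e (p ^ a) - lucas t' e' (p ^ a))%Z /\
  (p%:Z ^+ a.+1 %| e ^+ (p ^ a) - e' ^+ (p ^ a))%Z.
Proof.
move=> p_pr pt pe; elim: a => [|a [IHt IHe]]; first by rewrite expn0 !expr1.
have pq : (p%:Z %| p%:Z ^+ a.+1)%Z by rewrite exprS dvdz_mulr.
rewrite exprSr; split; first by rewrite expnS !lucasM lucas_prime_lift.
by rewrite expnSr !exprM dvdz_expB.
Qed.

Lemma lucas_gauss (p s a : nat) (t e : int) : prime p ->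
  (p%:Z ^+ a.+1 %| lucas t e (s * p ^ a.+1) - lucas t e (s * p ^ a))%Z.
Proof.
move=> p_pr; rewrite ![(s * _)%N]mulnC !lucasM.
move: (lucas t e s) (e ^+ s) => u v; rewrite expnSr lucasM.
(* The pairs compared are [Psi(u, v)] and [(u, v)]; they agree modulo [p] by Fermat's little
   theorem. *)
apply: (proj1 (lucas_pfactor_lift _ _ _ _ _ _ p_pr _ _)); last exact: dvdz_exp_prime_sub.
have [Q _ ->] := lucas_prime p p_pr.
by rewrite addrAC rpredD ?dvdz_exp_prime_sub ?dvdz_mulr.
Qed.

(** * From the Gauss congruences to [Phi1] *)

Lemma prod_distinct_primes_dvdn (I : finType) (f : I -> nat) (T : {set I}) N :
  injective f -> (forall i, prime (f i)) -> (forall i, f i %| N)%N ->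
  (\prod_(i in T) f i %| N)%N.
Proof.
move=> f_inj f_pr f_dvd; rewrite -big_enum /=.
elim: (enum T) (enum_uniq T) => [|i r IHr] /=; first by rewrite big_nil dvd1n.
case/andP=> ir r_uniq; rewrite big_cons Gauss_dvd ?f_dvd ?IHr //.
rewrite big_seq; elim/big_rec: _ => [|j P jr coP]; first exact: coprimen1.
rewrite coprimeMr coP andbT prime_coprime // dvdn_prime2 // inj_eq //.
by apply: contra ir => /eqP->.
Qed.

(* Pairing T with [p |: T] turns the alternating sum into differences
   [phi (s p^a) - phi (s p^(a-1))], where [a] is the exponent of [p] in [k]. *)
Lemma Phi1_dvd (phi : nat -> int) (k : nat) :
  (forall p s a : nat, prime p -> (0 < s)%N ->
     (p%:Z ^+ a.+1 %| phi (s * p ^ a.+1)%N - phi (s * p ^ a)%N)%Z) ->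
  (0 < k)%N -> (k%:Z %| Phi1 k phi)%Z.
Proof.
(* It suffices that each prime-power part of [k] divides the sum. *)
move=> gauss k_gt0; rewrite dvdzE /=; apply/dvdn_partP => // p.
rewrite p_part => p_k; rewrite -[X in (X %| _)%N]/`|(p ^ logn p k)%N%:Z|%N -dvdzE.
have pk : p \in primes k by [].
have p_pr : prime p by move: pk; rewrite mem_primes => /andP[].
have i0P : (index p (primes k) < size (primes k))%N by rewrite index_mem.
pose i0 := Ordinal i0P; pose f (i : 'I_(size (primes k))) := nth 0%N (primes k) i.
have fi0 : f i0 = p by rewrite /f /= nth_index.
have f_in i : f i \in primes k by rewrite mem_nth.
have f_pr i : prime (f i) by have := f_in i; rewrite mem_primes => /andP[].
have f_dvd i : (f i %| k)%N by have := f_in i; rewrite mem_primes => /and3P[].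
have f_inj : injective f.
  move=> i j /eqP; rewrite nth_uniq ?primes_uniq // => /eqP; exact: val_inj.
rewrite /Phi1 (bigID (fun T : {set _} => i0 \in T)) /=.
rewrite (reindex_onto (fun T => i0 |: T) (fun T => T :\ i0)) /=; last first.
  by move=> T; exact: setD1K.
rewrite (eq_bigl (fun T : {set _} => i0 \notin T)); last first.
  move=> T; rewrite setU11 /=; apply/eqP/idP => [<-|/setU1K //].
  by rewrite setD11.
rewrite -big_split /= rpred_sum // => T i0T.
rewrite cardsU1 i0T big_setU1 //= exprS mulN1r mulNr addrC -mulrBr dvdz_mull //.
rewrite nth_index // -[\prod_(i in T) _]/(\prod_(i in T) f i)%N.
set P := (\prod_(i in T) f i)%N.
have P_dvd : (P %| k)%N by exact: prod_distinct_primes_dvdn.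
have P_gt0 : (0 < P)%N by apply: dvdn_gt0 P_dvd.
have [u cop_u kE] := pfactor_coprime p_pr k_gt0.
have coP : coprime p P.
  apply: (big_ind (fun x => coprime p x)) => [|x y cx cy|i iT].
  - exact: coprimen1.
  - by rewrite coprimeMr cx.
  rewrite prime_coprime // dvdn_prime2 // -fi0 inj_eq //.
  by apply: contraNneq i0T => ->.
(* As [P] is coprime to [p], it divides the [p]-free part [u]; the quotient [s = u / P] is the
   common factor of the two arguments of [phi]. *)
have : (P %| u)%N.
  by rewrite -(@Gauss_dvdl _ _ (p ^ logn p k)) -?kE // coprime_sym coprimeXl.
case/dvdnP=> s uE.
have [a aE] : exists a, logn p k = a.+1.
  by exists (logn p k).-1; rewrite prednK // logn_gt0.
have s_gt0 : (0 < s)%N by move: k_gt0; rewrite kE uE !muln_gt0 => /andP[/andP[]].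
rewrite aE in kE *; rewrite kE.
have -> : ((u * p ^ a.+1) %/ P = s * p ^ a.+1)%N by rewrite uE mulnAC mulnK.
have -> : ((u * p ^ a.+1) %/ (p * P) = s * p ^ a)%N.
  rewrite uE expnS -[RHS](@mulnK _ (p * P)) ?muln_gt0 ?(prime_gt0 p_pr) //.
  by congr (_ %/ _)%N; ring.
by rewrite -natz natrX natz gauss.
Qed.

(** * Formal power series *)

(** Truncation transfers commutativity and associativity from polynomials to series. *)
Lemma coef_mul_trunc {R : comUnitRingType} (f g : fps R) N k : (k < N)%N ->
  ((\poly_(i < N) f i) * (\poly_(i < N) g i))`_k = fps_mul f g k.
Proof.
move=> lt_kN; rewrite coefM; apply: eq_bigr => i _.
by rewrite !coef_poly !(leq_ltn_trans _ lt_kN) ?leq_subr // -ltnS.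
Qed.

Lemma eq_fps_mul {R : comUnitRingType} (f f' g g' : fps R) :
  f =1 f' -> g =1 g' -> fps_mul f g =1 fps_mul f' g'.
Proof. by move=> ff gg k; apply: eq_bigr => i _; rewrite ff gg. Qed.

Lemma fps_mulC {R : comUnitRingType} (f g : fps R) : fps_mul f g =1 fps_mul g f.
Proof. by move=> k; rewrite -!(coef_mul_trunc _ _ _ _ (ltnSn k)) mulrC. Qed.

Lemma fps_mulA {R : comUnitRingType} (f g h : fps R) :
  fps_mul f (fps_mul g h) =1 fps_mul (fps_mul f g) h.
Proof.
move=> k; pose P (u : fps R) := \poly_(i < k.+1) u i.
have PE u i : (i < k.+1)%N -> (P u)`_i = u i by rewrite coef_poly => ->.
transitivity (P f * (P g * P h))`_k.
  rewrite coefM; apply: eq_bigr => i _; rewrite PE // coef_mul_trunc //.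
  by rewrite ltnS leq_subr.
rewrite mulrA coefM; apply: eq_bigr => i _.
by rewrite coef_mul_trunc // PE // ltnS leq_subr.
Qed.

Lemma fps_mul1 {R : comUnitRingType} (f : fps R) : fps_mul f (fps_of_poly 1) =1 f.
Proof.
move=> k; rewrite /fps_mul big_ord_recr /= subnn /fps_of_poly coef1 mulr1.
rewrite big1 ?add0r // => i _.
by rewrite coef1 subn_eq0 leqNgt ltn_ord mulr0.
Qed.

Lemma fps_div_eq {R : comUnitRingType} (f g h : fps R) : g 0%N \is a GRing.unit ->
  fps_mul h g =1 f -> h =1 fps_div f g.
Proof.
move=> g0 hg k; rewrite -[LHS]fps_mul1.
rewrite -(eq_fps_mul _ _ _ _ (frefl h) (fps_mulV g0)) fps_mulA.
exact: eq_fps_mul.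
Qed.

Lemma genfun_d_mul (m n : int) :
  fps_mul (genfun (d m n)) (fps_of_poly (1 - n *: 'X - m *: 'X^2)) =1
  fps_of_poly (n *: 'X + (2 * m) *: 'X^2).
Proof.
move=> k; rewrite fps_mulC /fps_mul /fps_of_poly.
case: k => [|[|[|k]]].
- by rewrite big_ord1 !coefE /=; ring.
- by rewrite !big_ord_recl big_ord0 !coefE /=; ring.
- by rewrite !big_ord_recl big_ord0 !coefE /=; ring.
(* The denominator has degree at most 2, so three terms survive and cancel by the recurrence for
   [d]. *)
rewrite 3!big_ord_recl big1 => [|i _]; last by rewrite !coefE /= !mulr0 !subr0 mul0r.
by rewrite !coefE /=; ring.
Qed.

Theorem theorem5 (n m : int) (hn : 2 <= n) (hm : 1 - n <= m <= n) :
  (forall k : nat, (1 <= k)%N -> (Phi1 k (d m n) = 0 %[mod k])%Z) /\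
  genfun (d m n) =1
    fps_div (fps_of_poly (n *: 'X + (2 * m) *: 'X^2))
            (fps_of_poly (1 - n *: 'X - m *: 'X^2)).
Proof.
split=> [k k_gt0|]; last first.
  apply: fps_div_eq (genfun_d_mul m n).
  by rewrite /fps_of_poly !coefE /= !mulr0 !subr0 unitr1.
apply/eqP; rewrite eqz_mod_dvd subr0; apply: Phi1_dvd => // p s a p_pr s_gt0.
rewrite !d_lucas ?muln_gt0 ?expn_gt0 ?s_gt0 ?prime_gt0 //.
exact: lucas_gauss.
Qed.
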